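(* Let $X$ be a real Hausdorff locally convex space, let $\alpha\in(0,1]$, and let $\mu$ be a nonzero (possibly signed) Radon measure on $X$. The space $D^\alpha(\mu)$ equipped with the translation invariant metric $$d_{D^\alpha(\mu)}(h_1,h_2):=V^\alpha(\mu;h_1-h_2)$$ is a complete metric vector space compactly embedded into the space $X$.
   Context: For a Radon measure $\mu$ on $X$ (finite, possibly signed) and $h\in X$ put $\mu_h(A):=\mu(A-h)$ for Borel sets $A$; $\|\cdot\|_{\mathrm{TV}}$ is the total variation norm. The measure $\mu$ is called $\alpha$-H\''older along a vector $h\in X$ if $\|\mu_{th}-\mu\|_{\mathrm{TV}}\le C|t|^\alpha$ for all $t\in\mathbb{R}$, for some number $C$; the infimum of such numbers $C$ is denoted by $V^\alpha(\mu;h)$. $D^\alpha(\mu)$ is the set of all vectors $h\in X$ such that $\mu$ is $\alpha$-H\''older along $h$. ''Compactly embedded'' means that the identity embedding takes bounded sets of $(D^\alpha(\mu),d_{D^\alpha(\mu)})$ to relatively compact sets in $X$. *)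

(* Defs.v *)
From HB Require Import structures.
From mathcomp Require Import all_boot all_order all_algebra.
From mathcomp Require Import all_classical all_reals all_analysis.

Set Implicit Arguments.
Unset Strict Implicit.
Unset Printing Implicit Defensive.

Import Order.TTheory GRing.Theory Num.Theory.
Import numFieldNormedType.Exports.

Local Open Scope classical_set_scope.
Local Open Scope ring_scope.

(* [g_sigma_algebraType] needs a pointed carrier. A copy of X is used because X
   may already be pointed through another structure. *)
Definition pointed_tvs (R : numDomainType) (X : tvsType R) : Type := X.
HB.instance Definition _ (R : numDomainType) (X : tvsType R) :=
  Choice.copy (pointed_tvs X) X.
HB.instance Definition _ (R : numDomainType) (X : tvsType R) :=
  isPointed.Build (pointed_tvs X) (0 : X).

Definition borel (R : numDomainType) (X : tvsType R) :=
  g_sigma_algebraType (@open X : set (set (pointed_tvs X))).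
HB.instance Definition _ (R : numDomainType) (X : tvsType R) :=
  Measurable.on (borel X).

Section total_variation.
Context d (T : measurableType d) (R : realType).
Implicit Type nu : {charge set T -> \bar R}.

(* |nu| = nu^+ + nu^-; by [Hahn_decomposition_uniq] its values on measurable
   sets do not depend on the Hahn decomposition picked here. *)
Definition total_variation nu : set T -> \bar R :=
  charge_variation (svalP (cid (svalP (cid (Hahn_decomposition nu))))).

Definition tv_norm nu : \bar R := total_variation nu [set: T].

End total_variation.

Section hoelder_measures.
Context {R : realType} {X : tvsType R}.
Implicit Types (mu : {charge set (borel X) -> \bar R}) (h : X) (alpha : R).

Definition radon mu : Prop :=
  forall A : set (borel X), measurable A -> forall e : R, 0 < e ->
  exists K : set X,
    [/\ compact K, K `<=` A & (total_variation mu (A `\` K) < e%:E)%E].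

Lemma measurable_translation h :
  measurable_fun [set: borel X] (fun x : borel X => (x : X) + h : borel X).
Proof.
apply: (@measurability _ _ (borel X) (borel X) setT _ (@open X)) => //.
move=> _ [B oB <-]; rewrite setTI; apply: sub_sigma_algebra.
have := oB; apply: (open_comp (f := fun x : X => x + h)) => x _.
rewrite (_ : (fun y : X => y + h) =
  (fun p : X * X => p.1 + p.2) \o (fun y => (y, h)))//.
apply: continuous_comp; last exact: add_continuous.
by apply: cvg_pair; [exact: cvg_id|exact: cvg_cst].
Qed.

(* mu_h(A) = mu(A - h), where A - h is the preimage of A under x |-> x + h. *)
Definition translate mu h : {charge set (borel X) -> \bar R} :=
  measure_function_pushforward__canonical__charge_Charge
    mu (measurable_translation h).

Definition hoelder_bound alpha mu h : set R :=
  [set C | forall t : R,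
    (tv_norm (cadd (translate mu (t *: h)) (copp mu))
       <= (C * `|t| `^ alpha)%:E)%E].

Definition hoelder_along alpha mu h : Prop :=
  exists C : R, hoelder_bound alpha mu h C.

(* Only meaningful when mu is alpha-Hoelder along h: [inf] is 0 on the empty
   set. *)
Definition hoelder_const alpha mu h : R := inf (hoelder_bound alpha mu h).

Definition hoelder_space alpha mu : set X := [set h | hoelder_along alpha mu h].

Definition hoelder_dist alpha mu (h1 h2 : X) : R :=
  hoelder_const alpha mu (h1 - h2).

End hoelder_measures.

Section metric_subspaces.
Context {R : realType} {X : tvsType R}.
Implicit Types (D B : set X) (d : X -> X -> R).

(* The set D is a linear subspace of X, d restricted to D is a metric for which
   the vector operations are continuous, and (D, d) is complete. The metric
   space (D, d) is given by M together with a bijective isometry i : M -> D, and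
   the existence of [add] and [scale] includes the closure of D under the
   operations of X. The topology of X plays no role here. *)
Definition complete_metric_vector_space D d : Prop :=
  D 0 /\
  exists (M : metricType R) (i : M -> X)
         (add : M * M -> M) (scale : R^o * M -> M),
    [/\ set_bij [set: M] D i /\ (forall x y, mdist x y = d (i x) (i y)),
        forall p, i (add p) = i p.1 + i p.2,
        forall p, i (scale p) = p.1 *: i p.2,
        continuous add /\ continuous scale
      & forall F : set_system M, ProperFilter F -> cauchy F ->
        exists p : M, F --> p].

Definition translation_invariant D d : Prop :=
  forall h1 h2 h, D h1 -> D h2 -> D h -> d (h1 + h) (h2 + h) = d h1 h2.

Definition dist_bounded d B : Prop :=
  exists M : R, forall h1 h2, B h1 -> B h2 -> d h1 h2 <= M.

Definition compactly_embedded D d : Prop :=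
  forall B, B `<=` D -> dist_bounded d B -> precompact B.

End metric_subspaces.

(* Main.v *)
(* The translates mu_h and mu have the same total mass, so the total variation
   of mu_h - mu is at most c iff 2 |mu(A - h) - mu(A)| <= c for every Borel A.
   For each c this condition is closed in h: by the Radon property A and its
   complement are exhausted, up to small mass, by disjoint compact sets, and an
   open set separating them is almost invariant under small translations.
   Moreover, for some c > 0 the condition confines h to a difference K - L of
   compact sets, since a translate of K disjoint from L carries little mass.
   Scaling then puts every ball of D^alpha(mu) in a compact subset of X; a
   Cauchy filter therefore has a cluster point in X, which is its limit by
   closedness. *)
Require Import Defs.
From HB Require Import structures.
From mathcomp Require Import all_boot all_order all_algebra.
From mathcomp Require Import all_classical all_reals all_analysis.
From mathcomp Require Import ring lra.

Set Implicit Arguments.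
Unset Strict Implicit.
Unset Printing Implicit Defensive.

Import Order.TTheory GRing.Theory Num.Theory.
Import numFieldNormedType.Exports.

Local Open Scope classical_set_scope.
Local Open Scope ring_scope.

(** * Values and total variation of a finite signed measure *)

Section charge_mass.
Context d (T : measurableType d) (R : realType).
Variable nu : {charge set T -> \bar R}.

Definition mass (A : set T) : R := fine (nu A).

Lemma massE A : measurable A -> nu A = (mass A)%:E.
Proof. by move=> mA; rewrite /mass fineK// fin_num_measure. Qed.

Lemma massID A B : measurable A -> measurable B ->
  mass A = mass (A `\` B) + mass (A `&` B).
Proof.
move=> mA mB; apply: EFin_inj; rewrite EFinD -!massE//.
- exact: chargeDI.
- exact: measurableI.
- exact: measurableD.
Qed.

Lemma massC_null A : nu setT = 0%E -> measurable A -> mass (~` A) = - mass A.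
Proof.
move=> nuT mA; have := massID measurableT mA.
by rewrite setTI setTD {1}/mass nuT/= => /esym/eqP; rewrite addr_eq0 => /eqP.
Qed.

(** For measurable S this controls |nu|(S) up to a factor 2, without mentioning a Hahn
    decomposition; smallness from the Radon property is used in this form. *)
Definition mass_le (S : set T) (e : R) : Prop :=
  forall B, measurable B -> B `<=` S -> `|mass B| <= e.

Lemma total_variationE : exists P N (nuPN : hahn_decomposition nu P N),
  Defs.total_variation nu = charge_variation nuPN.
Proof. by do 3!eexists. Qed.

Lemma mass_le_total_variation (S : set T) (e : R) : measurable S ->
  (Defs.total_variation nu S < e%:E)%E -> mass_le S e.
Proof.
have [P [N [nuPN ->]]] := total_variationE => mS Se B mB BS.
have := abse_charge_variation nuPN mB; rewrite massE// => Bv.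
rewrite -lee_fin (le_trans Bv)// (le_trans _ (ltW Se))//.
by rewrite le_measure// inE.
Qed.

(** The masses of E and A differ by those of E minus A, which avoids A and L, and of A minus E,
    which avoids K. *)
Lemma mass_dist (A E K L : set T) (e : R) : measurable A -> measurable E ->
  K `<=` E -> L `&` E = set0 ->
  mass_le (A `\` K) e -> mass_le (~` A `\` L) e ->
  `|mass E - mass A| <= e + e.
Proof.
move=> mA mE KE LE AK AL; rewrite (massID mE mA) (massID mA mE) (setIC A).
rewrite opprD addrACA subrr addr0 (le_trans (ler_normB _ _))//.
apply: lerD; [apply: AL; first exact: measurableD|apply: AK].
- by move=> x [Ex Ax]; split=> // Lx; rewrite -[False]/(set0 x) -LE.
- exact: measurableD.
- by move=> x [Ax Ex]; split=> // /KE.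
Qed.

(** For a Hahn decomposition (P, N), zero total mass gives nu(N) = - nu(P), so the norm is 2 nu(P).
    Moreover P maximizes nu, because nu is nonnegative on P minus A and nonpositive on A minus P. *)
Lemma tv_norm_le (c : R) : nu setT = 0%E ->
  (tv_norm nu <= c%:E)%E <-> forall A, measurable A -> 2 * mass A <= c.
Proof.
move=> nuT; have [P [N [nuPN tvE]]] := total_variationE; rewrite /tv_norm tvE.
rewrite /charge_variation /= jordan_posE jordan_negE cjordan_posE cjordan_negE.
rewrite /crestr0 mem_set// /crestr !setTI.
case: (nuPN) => [[mP posP] [mN negN] PNT PN0].
have NP : N = ~` P.
  apply/seteqP; split=> [x Nx Px|x Px]; first by rewrite -[False]/(set0 x) -PN0.
  by have : setT x by []; rewrite -PNT => -[].
rewrite !massE// -EFinN -EFinD lee_fin NP massC_null// opprK.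
split=> [Pc A mA|Ac]; last by have := Ac _ mP; lra.
have /posP := measurableD mP mA; move=> /(_ (@subDsetl _ _ _)).
have /negN := measurableD mA mP; rewrite NP => /(_ (@subIsetr _ _ _)).
rewrite !massE ?lee_fin; try exact: measurableD.
by have := massID mP mA; have := massID mA mP; rewrite setIC; lra.
Qed.

End charge_mass.

(** * Translates of sets and the change of their mass *)

Section shifted_charge.
Context {R : realType} {X : tvsType R} (mu : {charge set (borel X) -> \bar R}).
Implicit Types (h k : X) (A B : set X) (c : R).

Definition shift h A : set X := [set x | A (x + h)].

Lemma shift0 A : shift 0 A = A.
Proof. by apply/seteqP; split=> x; rewrite /shift/= addr0. Qed.

Lemma shiftD h k A : shift h (shift k A) = shift (h + k) A.
Proof. by apply/seteqP; split=> x; rewrite /shift/= addrA. Qed.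

Lemma measurable_shift h A :
  measurable (A : set (borel X)) -> measurable (shift h A : set (borel X)).
Proof.
by move=> mA; have := measurable_translation h measurableT mA; rewrite setTI.
Qed.

Definition shift_bound h c : Prop := forall A, measurable (A : set (borel X)) ->
  2 * `|mass mu (shift h A) - mass mu A| <= c.

(** The charge mu_h - mu has total mass 0, so [tv_norm_le] applies; passing from A to its complement
    flips the sign, which accounts for the absolute value. *)
Lemma tv_norm_shift h c :
  (tv_norm (cadd (translate mu h) (copp mu)) <= c%:E)%E <-> shift_bound h c.
Proof.
set nu := (X in tv_norm X).
have nuE A : measurable (A : set (borel X)) ->
    nu A = (mass mu (shift h A) - mass mu A)%:E.
  move=> mA; rewrite EFinB -!massE//; last exact: measurable_shift.
have mE A : measurable (A : set (borel X)) ->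
    mass nu A = mass mu (shift h A) - mass mu A.
  by move=> mA; rewrite {1}/mass nuE.
have nuT : nu setT = 0%E.
  by rewrite nuE// (_ : shift h setT = setT) ?subrr// -subTset.
rewrite tv_norm_le//; split=> H A mA.
- have := H _ mA; have := H _ (measurableC mA).
  rewrite (massC_null nuT)// mE//.
  by case: (ger0P (mass mu (shift h A) - mass mu A)); lra.
- have := H _ mA; rewrite mE//.
  by have := ler_norm (mass mu (shift h A) - mass mu A); lra.
Qed.

Lemma shift_bound0 c : 0 <= c -> shift_bound 0 c.
Proof. by move=> c0 A mA; rewrite shift0 subrr normr0 mulr0. Qed.

Lemma shift_bound_ge0 h c : shift_bound h c -> 0 <= c.
Proof. by move=> /(_ _ measurable0); apply: le_trans; rewrite mulr_ge0. Qed.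

Lemma shift_bound_le h c c' : c <= c' -> shift_bound h c -> shift_bound h c'.
Proof. by move=> cc' hc A /hc /le_trans; exact. Qed.

Lemma shift_boundD h k c c' :
  shift_bound h c -> shift_bound k c' -> shift_bound (h + k) (c + c').
Proof.
move=> hc kc A mA; rewrite -shiftD.
have := hc _ (measurable_shift k mA); have := kc _ mA.
have := ler_normD (mass mu (shift h (shift k A)) - mass mu (shift k A))
  (mass mu (shift k A) - mass mu A).
by rewrite addrA subrK; lra.
Qed.

Lemma translation_continuous h : continuous (fun x : X => x + h).
Proof.
move=> x; apply: (@continuous_comp _ _ _ (fun x => (x, h))
  (fun p : X * X => p.1 + p.2)); last exact: add_continuous.
by apply: cvg_pair; [exact: cvg_id|exact: cvg_cst].
Qed.

Lemma dilation_continuous (t : R) : continuous (fun x : X => t *: x).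
Proof.
move=> x; apply: (@continuous_comp _ _ _ (fun x => (t, x))
  (fun z : R^o * X => z.1 *: z.2)); last exact: scale_continuous.
by apply: (@cvg_pair _ _ _ _ (nbhs (t : R^o))); [exact: cvg_cst|exact: cvg_id].
Qed.

(** * Closedness and compactness of the sets of admissible shifts *)

Hypothesis X_hausdorff : hausdorff_space X.

Lemma measurable_compact (K : set X) :
  compact K -> measurable (K : set (borel X)).
Proof.
move=> /(compact_closed X_hausdorff) /closed_openC oK.
rewrite -[K]setCK; apply: (@measurableC _ (borel X)).
exact: sub_sigma_algebra.
Qed.

Hypothesis mu_radon : radon mu.

Lemma radon_mass A (e : R) : measurable (A : set (borel X)) -> 0 < e ->
  exists K, [/\ compact K, K `<=` A & mass_le mu (A `\` K) e].
Proof.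
move=> mA /(mu_radon mA)[K [cK KA Ke]]; exists K; split=> //.
apply: mass_le_total_variation => //.
by apply: (@measurableD _ (borel X)) => //; exact: measurable_compact.
Qed.

(* The difference set L - K is compact and does not contain 0. *)
Lemma separate_compact (K L : set X) : compact K -> compact L ->
  K `&` L = set0 -> exists2 W : set X, open_nbhs 0 W &
    forall k l w w', K k -> L l -> W w -> W w' -> k + w <> l + w'.
Proof.
move=> cK cL KL.
have : compact ((fun p : X * X => p.1 - p.2) @` (L `*` K)).
  apply: continuous_compact; last exact: compact_setX.
  by apply: continuous_subspaceT; exact: sub_continuous.
set Q := _ @` _ => /(compact_closed X_hausdorff)/closed_openC oQ.
have [[W1 W2] /= [n1 n2] W12] :
    nbhs ((0, 0) : X * X) [set p | (~` Q) (p.1 - p.2)].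
  apply: (@sub_continuous X (0, 0)); rewrite /= subrr; apply: open_nbhs_nbhs.
  split=> // -[[l k]] /= [Ll Kk] /eqP; rewrite subr_eq0 => /eqP lk.
  by rewrite -[False]/(set0 k) -KL; split=> //; rewrite -lk.
have : nbhs (0 : X) (W1 `&` W2) by exact: filterI.
rewrite nbhsE => -[W oW WW]; exists W => // k l w w' Kk Ll.
move=> /WW[W1w _] /WW[_ W2w'] kl.
apply: (W12 (w, w')) => //=; exists (l, k) => //=.
by apply: (addIr w'); rewrite subrK addrAC -kl addrC addKr.
Qed.

(** A vector h' near h that satisfies the bound is tested on an open U, chosen before h', such that
    U is close in mass to A and its shift by h' to the shift of A by h. *)
Lemma shift_bound_closed c : closed [set h | shift_bound h c].
Proof.
move=> h cl_h A mA; apply/ler_addgt0Pr => e e0.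
(* Four approximations cost e/8 each, in total e/2, and [shift_bound] doubles this to e. *)
have e8 : 0 < e / 8 by rewrite divr_gt0.
have mhA := measurable_shift h mA.
have [K1 [cK1 K1A mK1]] := radon_mass mhA e8.
have [L1 [cL1 L1A mL1]] := radon_mass (measurableC mhA) e8.
have [K2 [cK2 K2A mK2]] := radon_mass mA e8.
have [L2 [cL2 L2A mL2]] := radon_mass (measurableC mA) e8.
have cD (K : set X) : compact K -> compact ((+%R^~ h) @` K).
  move=> cK; apply: continuous_compact => //; apply: continuous_subspaceT.
  exact: translation_continuous.
(* Moved by h, the sets K1 and L1 land in A and in its complement, so K and L stay disjoint. *)
pose K := (+%R^~ h) @` K1 `|` K2; pose L := (+%R^~ h) @` L1 `|` L2.
have [||| W oW WKL] := @separate_compact K L.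
- by apply: compactU => //; exact: cD.
- by apply: compactU => //; exact: cD.
- rewrite -subset0 => x [Kx Lx].
  have Ax : A x by case: Kx => [[y /K1A Ay <-]|/K2A].
  by case: Lx => [[y /L1A Ay xy]|/L2A]; [apply: Ay; rewrite /shift/= xy|].
have [W0 oW0] : W 0 /\ open W by case: oW.
(* U is the open set K + W. It is disjoint from L + W, so the estimates survive a further
   translation by h' - h in W. *)
pose U := \bigcup_(k in K) (fun x => x - k) @^-1` W.
have mU : measurable (U : set (borel X)).
  apply: sub_sigma_algebra; apply: bigcup_open => k _.
  by apply: open_comp => // x _; exact: translation_continuous.
have [h' [hc Wh']] : exists h', shift_bound h' c /\ W (h' - h).
  apply: cl_h; apply: (@translation_continuous (- h) h).
  by rewrite subrr; exact: open_nbhs_nbhs.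
have UA : `|mass mu U - mass mu A| <= e / 8 + e / 8.
  apply: mass_dist mK2 mL2 => //.
    by move=> x Kx; exists x; [right|rewrite /= subrr].
  rewrite -subset0 => l [Ll [k Kk /= Wlk]].
  by apply: (WKL k l (l - k) 0) => //; [right|rewrite addr0 addrC subrK].
have UhA : `|mass mu (shift h' U) - mass mu (shift h A)| <= e / 8 + e / 8.
  apply: mass_dist mK1 mL1 => //; first exact: measurable_shift.
    move=> x Kx; exists (x + h); first by left; exists x.
    by rewrite /= opprD addrACA subrr add0r.
  rewrite -subset0 => l [Ll [k Kk /= Wlk]].
  apply: (WKL k (l + h) (l + h' - k) (h' - h)) => //; first by left; exists l.
  by rewrite addrC subrK [h' - h]addrC addrA addrK.
have := hc _ mU; move: UA UhA; rewrite -[in X in _ -> X -> _]normrN.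
have := ler_normD (- (mass mu (shift h' U) - mass mu (shift h A)))
  (mass mu (shift h' U) - mass mu U).
have := ler_normD (- (mass mu (shift h' U) - mass mu (shift h A)) +
  (mass mu (shift h' U) - mass mu U)) (mass mu U - mass mu A).
rewrite (_ : _ + _ + _ = mass mu (shift h A) - mass mu A); last by ring.
lra.
Qed.

Hypothesis mu_neq0 : exists A : set (borel X), measurable A /\ mu A <> 0%E.

(** If h is outside K - L, then K shifted by h misses L and carries at most a third of |mu(K)|. The
    doubled change of mass is then at least 4/3 of |mu(K)|, which exceeds c = |mu(K)|. *)
Lemma shift_bound_compact :
  exists2 Q : set X, compact Q & exists2 c, 0 < c & shift_bound^~ c `<=` Q.
Proof.
have [A [mA muA]] := mu_neq0.
have mA0 : 0 < `|mass mu A|.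
  by rewrite normr_gt0; apply: contra_notN muA; rewrite massE// => /eqP ->.
(* Losing at most half of |mu(A)| keeps mu(K) nonzero. *)
have [K [cK KA Ke]] := radon_mass mA (divr_gt0 mA0 (ltr0n R 2)).
have mK := measurable_compact cK.
have mK0 : 0 < `|mass mu K|.
  rewrite normr_gt0; apply/negP => /eqP mK0.
  have := Ke _ (measurableD mA mK) (@subset_refl _ _).
  by have := massID mu mA mK; rewrite setIidr// mK0 addr0 => <-; lra.
have [L [cL _ Le]] := radon_mass measurableT (divr_gt0 mK0 (ltr0n R 3)).
exists ((fun p : X * X => p.1 - p.2) @` (K `*` L)).
  apply: continuous_compact; last exact: compact_setX.
  by apply: continuous_subspaceT; exact: sub_continuous.
exists `|mass mu K| => // h /(_ _ mK) hK; apply: contrapT => KL.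
have : `|mass mu (shift h K)| <= `|mass mu K| / 3.
  apply: Le; first exact: measurable_shift.
  move=> x Kx; split=> // Lx; apply: KL; exists (x + h, x) => //=.
  by rewrite addrC addKr.
have := ler_normB (mass mu (shift h K)) (mass mu (shift h K) - mass mu K).
rewrite opprB addrC subrK; lra.
Qed.

(** Let q be a cluster point of the multiples (n+1) h. Rescaling by 1/(n+1), which tends to 0, shows
    that h lies in every neighbourhood of 0 q = 0. *)
Lemma compact_line_eq0 (Q : set X) h :
  compact Q -> (forall t : R, Q (t *: h)) -> h = 0.
Proof.
move=> cQ Qh; pose F := (fun n : nat => n.+1%:R *: h : X) @ \oo.
have FQ : F Q by exists 0%N => // n _; exact: Qh.
have [q [_ clq]] := cQ F _ FQ.
apply/esym/X_hausdorff => A B A0 Bh.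
exists h; split; last exact: nbhs_singleton.
have : nbhs ((0 : R^o) *: q) A by rewrite scale0r.
move=> /(@scale_continuous R X (0, q)) [[W1 W2] /= [W10 W2q] WA].
have FW1 : \forall n \near \oo, W1 (n.+1%:R^-1).
  by have /(_ W1 W10) := @cvg_harmonic R.
pose S := [set x : X | exists n, W1 n.+1%:R^-1 /\ x = (n.+1%:R : R) *: h].
have FS : F S by apply: filterS FW1 => n W1n; exists n.
have [_ [[n [W1n ->]] W2n]] := clq _ _ FS W2q.
have := WA (n.+1%:R^-1, n.+1%:R *: h) (conj W1n W2n).
by rewrite /= scalerA mulVf ?pnatr_eq0// scale1r.
Qed.

(** * The Hoelder constant: algebra, compact balls and completeness *)

Variable alpha : R.
Hypothesis alpha_gt0 : 0 < alpha.

Let bound h c := hoelder_bound alpha mu h c.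
Let V h := hoelder_const alpha mu h.
Let D := hoelder_space alpha mu.

Lemma hoelder_boundE h c :
  bound h c <-> forall t : R, shift_bound (t *: h) (c * `|t| `^ alpha).
Proof. by split=> hc t; apply/tv_norm_shift; exact: hc. Qed.

Lemma hoelder_bound_ge0 h c : bound h c -> 0 <= c.
Proof.
by move=> /hoelder_boundE/(_ 1)/shift_bound_ge0; rewrite normr1 powR1 mulr1.
Qed.

Lemma hoelder_bound_le h c c' : c <= c' -> bound h c -> bound h c'.
Proof.
move=> cc' /hoelder_boundE hc; apply/hoelder_boundE => t.
by apply: shift_bound_le (hc t); rewrite ler_wpM2r// powR_ge0.
Qed.

Lemma hoelder_bound0 : bound 0 0.
Proof.
by apply/hoelder_boundE => t; rewrite scaler0 mul0r; exact: shift_bound0.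
Qed.

Lemma hoelder_boundD h k c c' :
  bound h c -> bound k c' -> bound (h + k) (c + c').
Proof.
move=> /hoelder_boundE hc /hoelder_boundE kc; apply/hoelder_boundE => t.
by rewrite scalerDr mulrDl; exact: shift_boundD.
Qed.

Lemma hoelder_boundZ (s : R) h c :
  bound h c -> bound (s *: h) (`|s| `^ alpha * c).
Proof.
move=> /hoelder_boundE hc; apply/hoelder_boundE => t.
rewrite scalerA (_ : `|s| `^ alpha * _ * _ = c * `|t * s| `^ alpha)//.
by rewrite normrM powRM//; ring.
Qed.

Lemma hoelder_bound_closed c : closed [set h | bound h c].
Proof.
rewrite (_ : mkset _ = \bigcap_(t in [set: R])
    ( *:%R t @^-1` [set h | shift_bound h (c * `|t| `^ alpha)])).
  apply: closed_bigI => t _.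
  apply: preimage_closed; last exact: shift_bound_closed.
  by move=> x _; exact: dilation_continuous.
apply/seteqP; split=> h; first by move=> /hoelder_boundE hc t _; exact: hc.
by move=> hc; apply/hoelder_boundE => t; exact: hc.
Qed.

Lemma hoelder_const_le h c : bound h c -> V h <= c.
Proof. by move=> hc; apply: ge_inf => //; exists 0 => x /hoelder_bound_ge0. Qed.

(** The infimum is attained: for fixed t and A the condition is a non-strict inequality, affine in
    the constant. *)
Lemma hoelder_const_bound h : D h -> bound h (V h).
Proof.
move=> Dh; apply/hoelder_boundE => t A mA.
apply/ler_addgt0Pr => e e0.
have p0 := powR_ge0 `|t| alpha.
(* Adding 1 keeps the denominator positive at t = 0. *)
have e1 : 0 < e / (`|t| `^ alpha + 1) by rewrite divr_gt0// ltr_wpDl.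
have [c hc cV] : exists2 c, bound h c & c < V h + e / (`|t| `^ alpha + 1).
  by apply: inf_adherent => //; split=> //; exists 0 => x /hoelder_bound_ge0.
have := (hoelder_boundE h c).1 hc t _ mA => /le_trans; apply.
rewrite (@le_trans _ _ ((V h + e / (`|t| `^ alpha + 1)) * `|t| `^ alpha))//.
  by rewrite ler_wpM2r// ltW.
rewrite mulrDl lerD2l mulrAC ler_pdivrMr ?ltr_wpDl//.
by rewrite ler_wpM2l ?ltW// ltrDl.
Qed.

Lemma hoelder_const_ge0 h : D h -> 0 <= V h.
Proof. by move=> /hoelder_const_bound/hoelder_bound_ge0. Qed.

Lemma hoelder_space0 : D 0.
Proof. by exists 0; exact: hoelder_bound0. Qed.

Lemma hoelder_spaceD h k : D h -> D k -> D (h + k).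
Proof. by move=> [c hc] [c' kc]; exists (c + c'); exact: hoelder_boundD. Qed.

Lemma hoelder_spaceZ (s : R) h : D h -> D (s *: h).
Proof. by move=> [c hc]; exists (`|s| `^ alpha * c); exact: hoelder_boundZ. Qed.

Lemma hoelder_spaceB h k : D h -> D k -> D (h - k).
Proof.
move=> Dh Dk; rewrite -scaleN1r.
by apply: hoelder_spaceD => //; exact: hoelder_spaceZ.
Qed.

Lemma hoelder_const0 : V 0 = 0.
Proof.
apply/eqP; rewrite eq_le hoelder_const_le; last exact: hoelder_bound0.
exact/hoelder_const_ge0/hoelder_space0.
Qed.

Lemma hoelder_constD h k : D h -> D k -> V (h + k) <= V h + V k.
Proof.
move=> Dh Dk; apply/hoelder_const_le/hoelder_boundD;
  exact: hoelder_const_bound.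
Qed.

Lemma hoelder_constZ (s : R) h : D h -> V (s *: h) <= `|s| `^ alpha * V h.
Proof.
by move=> Dh; apply/hoelder_const_le/hoelder_boundZ; exact: hoelder_const_bound.
Qed.

(** Once c t^alpha <= c0, the vector t h lies in the compact set Q of [shift_bound_compact], so h
    lies in its dilation by 1/t. *)
Lemma hoelder_bound_compact c :
  exists2 Q : set X, compact Q & [set h | bound h c] `<=` Q.
Proof.
have [Q cQ [c0 c0_gt0 Qc0]] := shift_bound_compact.
have [c_ge0|c_lt0] := leP 0 c; last first.
  exists Q => // h /hoelder_bound_ge0; lra.
(* This t solves t^alpha = c0 / (c + 1); the added 1 covers c = 0. *)
pose t := (c0 / (c + 1)) `^ alpha^-1.
have c1 : 0 < c + 1 by lra.
have t0 : 0 < t by rewrite powR_gt0// divr_gt0.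
exists ( *:%R t^-1 @` Q).
  apply: continuous_compact => //; apply: continuous_subspaceT => x.
  exact: dilation_continuous.
move=> h /hoelder_boundE/(_ t) ht; exists (t *: h).
  apply: Qc0; apply: shift_bound_le ht.
  rewrite gtr0_norm// /t -powRrM mulVf ?gt_eqF// powRr1; last first.
    by rewrite divr_ge0// ltW.
  by rewrite mulrCA ger_pMr// ler_pdivrMr//; lra.
by rewrite scalerA mulVf ?scale1r// gt_eqF.
Qed.

(** A zero constant puts the whole line through h into one compact set. *)
Lemma hoelder_const_eq0 h : D h -> V h = 0 -> h = 0.
Proof.
move=> /hoelder_const_bound /[swap] -> /hoelder_boundE h0.
have [Q cQ [c0 c0_gt0 Qc0]] := shift_bound_compact.
apply: (compact_line_eq0 cQ) => t; apply: Qc0.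
by apply: shift_bound_le (h0 t); rewrite mul0r ltW.
Qed.

Lemma hoelder_ball_compact h c :
  exists2 Q : set X, compact Q & [set k | bound (k - h) c] `<=` Q.
Proof.
have [Q cQ Qc] := hoelder_bound_compact c.
exists ((fun x => x + h) @` Q).
  apply: continuous_compact => //; apply: continuous_subspaceT.
  exact: translation_continuous.
by move=> k /Qc Qkh; exists (k - h) => //; rewrite subrK.
Qed.

Lemma hoelder_compactly_embedded :
  compactly_embedded D (hoelder_dist alpha mu).
Proof.
move=> B BD [M BM].
have [Q cQ BQ] : exists2 Q, compact Q & B `<=` Q.
  have [->|/set0P[h Bh]] := eqVneq B set0.
    by exists set0 => //; exact: compact0.
  have [Q cQ Qh] := hoelder_ball_compact h M; exists Q => // k Bk; apply: Qh.
  apply: hoelder_bound_le (BM _ _ Bk Bh) _.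
  by apply: hoelder_const_bound; apply: hoelder_spaceB; exact: BD.
apply: precompact_subset BQ _.
by rewrite precompact_closed//; exact: compact_closed.
Qed.

(** The filter lives on X, so that compactness in X supplies a cluster point as candidate limit. *)
Lemma hoelder_complete (F : set_system X) : ProperFilter F ->
  (forall e : R, 0 < e -> exists2 B, F B &
    B `<=` D /\ forall h k, B h -> B k -> V (h - k) <= e) ->
  exists2 p, D p & forall e : R, 0 < e -> \forall h \near F, V (p - h) <= e.
Proof.
move=> PF cF; have [B FB [BD B1]] := cF 1 ltr01.
have [h Bh] := filter_ex FB.
have [Q cQ Qh] := hoelder_ball_compact h 1.
have [p [_ Fp]] : exists p, Q p /\ cluster F p.
  apply: cQ; apply: filterS FB => k Bk; apply: Qh.
  apply: hoelder_bound_le (B1 _ _ Bk Bh) _.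
  by apply: hoelder_const_bound; apply: hoelder_spaceB; exact: BD.
have near_p e : 0 < e -> exists2 B, F B &
    forall k, B k -> D k /\ bound (p - k) e.
  move=> /cF[C FC [CD Ce]]; exists C => // k Ck; split; first exact: CD.
  (* The vector p - k is in the closure of the differences l - k with l in C, all of which have
     bound e. *)
  apply: hoelder_bound_closed => W.
  move=> /(translation_continuous (h := - k)) /(Fp _ _ FC)[l [Cl Wl]].
  exists (l - k); split=> //; apply: hoelder_bound_le (Ce _ _ Cl Ck) _.
  by apply: hoelder_const_bound; apply: hoelder_spaceB; exact: CD.
have [C FC Cp] := near_p 1 ltr01.
exists p => [|e /near_p[C' FC' C'p]].
  have [k Ck] := filter_ex FC; have [Dk pk] := Cp k Ck.
  by rewrite -(subrK k p); apply: hoelder_spaceD => //; exists 1.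
by apply: filterS FC' => k /C'p[_ pk]; exact: hoelder_const_le.
Qed.

End shifted_charge.

(** * Metric vector spaces from subadditive, alpha-homogeneous functionals *)

Section homogeneous_norm.
Context {R : realType} {X : tvsType R} (D : set X) (N : X -> R) (alpha : R).
Hypotheses (alpha_gt0 : 0 < alpha) (D0 : D 0)
  (DD : forall h k, D h -> D k -> D (h + k))
  (DZ : forall (s : R) h, D h -> D (s *: h)).
Hypotheses (N0 : N 0 = 0) (N_eq0 : forall h, D h -> N h = 0 -> h = 0)
  (ND : forall h k, D h -> D k -> N (h + k) <= N h + N k)
  (NZ : forall (s : R) h, D h -> N (s *: h) <= `|s| `^ alpha * N h).
Hypothesis complete_N : forall F : set_system X, ProperFilter F ->
  (forall e : R, 0 < e -> exists2 B, F B &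
    B `<=` D /\ forall h k, B h -> B k -> N (h - k) <= e) ->
  exists2 p, D p & forall e : R, 0 < e -> \forall h \near F, N (p - h) <= e.

Let DB h k : D h -> D k -> D (h - k).
Proof. by move=> Dh Dk; rewrite -scaleN1r; apply: DD => //; exact: DZ. Qed.

Let NN h k : D h -> D k -> N (h - k) = N (k - h).
Proof.
suff le h' k' : D h' -> D k' -> N (h' - k') <= N (k' - h').
  by move=> Dh Dk; apply/eqP; rewrite eq_le !le.
move=> Dh Dk; rewrite -opprB -scaleN1r.
by apply: le_trans (NZ _ (DB Dk Dh)) _; rewrite normrN1 powR1 mul1r.
Qed.

Let N_ge0 h : D h -> 0 <= N h.
Proof.
move=> Dh; have := ND Dh (DZ (-1) Dh); have := NZ (-1) Dh.
by rewrite scaleN1r subrr N0 normrN1 powR1; lra.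
Qed.

(** The metric is put on the subtype of D, whose topology thus comes from N and not from X. *)
Lemma homogeneous_norm_metric : exists (M : metricType R) (i : M -> X),
  set_bij [set: M] D i /\ forall x y, mdist x y = N (i x - i y).
Proof.
pose T := {h : X | h \in D}.
have DT (x : T) : D (val x) by exact/set_mem/valP.
pose dist (x y : T) := N (val x - val y).
have dist0 x : dist x x = 0 by rewrite /dist subrr.
have dist_eq0 x y : dist x y = 0 -> x = y.
  move=> /(N_eq0 (DB (DT x) (DT y)))/eqP.
  by rewrite subr_eq0 => /eqP/val_inj.
have distC x y : dist x y = dist y x by exact: NN.
have distD y x z : dist x z <= dist x y + dist y z.
  rewrite /dist -[val x - _](subrKA (val y)); apply: ND; exact: DB.
have surj x : D x -> exists y : T, val y = x.
  by move=> Dx; exists (Sub x (mem_set Dx)).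
pose M : metricType R := HB.pack T
  (@isMetric.Build R T dist dist0 dist_eq0 distC distD).
exists M, (val : T -> X).
split=> //; split.
- by move=> x _; exact: DT.
- by move=> x y _ _; exact: val_inj.
- by move=> x /surj[y <-]; exists y.
Qed.

Lemma complete_homogeneous_norm :
  complete_metric_vector_space D (fun h k => N (h - k)).
Proof.
split=> //; have [M [i [[iD i_inj i_surj] iN]]] := homogeneous_norm_metric.
have Di x : D (i x) by exact: iD.
have exM h : D h -> exists x, i x = h by move=> /i_surj[x _]; exists x.
have /choice[add addE] : forall p : M * M, exists x, i x = i p.1 + i p.2.
  by move=> p; apply/exM/DD.
have /choice[scale scaleE] : forall p : R^o * M, exists x, i x = p.1 *: i p.2.
  by move=> p; apply/exM/DZ.
exists M, i, add, scale; split=> //; first split.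
- move=> [x y]; apply/cvg_ballP => e e0; near=> z.
  have : ball x (e / 2) z.1.
    by near: z; apply: cvg_fst; apply: nbhsx_ballx; rewrite divr_gt0.
  have : ball y (e / 2) z.2.
    near: z; apply: (@cvg_snd _ _ (nbhs _) (nbhs _)); apply: nbhsx_ballx.
    by rewrite divr_gt0.
  rewrite !ballEmdist/= !iN !addE/= opprD addrACA => yz xz.
  by rewrite (le_lt_trans (ND (DB _ _) (DB _ _)))// [e]splitr ltrD.
- move=> [s x]; apply/cvg_ballP => e e0.
  pose c := N (i x) + 1.
  have Nx := N_ge0 (Di x); have c0 : 0 < c by rewrite /c; lra.
  (* Chosen so that d^alpha N(i x) <= e/2; the 1 in c allows N(i x) = 0. *)
  pose d := (e / 2 / c) `^ alpha^-1.
  have d0 : 0 < d by rewrite powR_gt0// !divr_gt0.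
  have dE : d `^ alpha = e / 2 / c.
    by rewrite /d -powRrM mulVf ?gt_eqF// powRr1// !divr_ge0// ltW.
  (* S bounds |z.1|^alpha as soon as z.1 is within 1 of s. *)
  pose S := (`|s| + 1) `^ alpha.
  have S0 : 0 < S by rewrite powR_gt0// ltr_wpDl.
  near=> z.
  have sz : `|s - z.1| < d.
    near: z; exact: (@cvg_fst _ _ (nbhs (s : R^o)) _ _ _
      (@nbhsx_ballx R R^o s d d0)).
  have s1z : `|s - z.1| < 1.
    near: z; exact: (@cvg_fst _ _ (nbhs (s : R^o)) _ _ _
      (@nbhsx_ballx R R^o s 1 ltr01)).
  have : ball x (e / 2 / S) z.2.
    near: z; apply: (@cvg_snd _ _ (nbhs _) (nbhs _)).
    by apply: nbhsx_ballx; rewrite !divr_gt0.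
  rewrite !ballEmdist/= !iN !scaleE/= => xz.
  rewrite (_ : _ - _ = z.1 *: (i x - i z.2) + (s - z.1) *: i x); last first.
    by rewrite scalerBr scalerBl [RHS]addrC subrKA.
  apply: (le_lt_trans (ND (DZ _ (DB (Di _) (Di _))) (DZ _ (Di _)))).
  rewrite [e]splitr ltr_leD//.
    apply: (le_lt_trans (NZ _ (DB (Di _) (Di _)))).
    apply: (@le_lt_trans _ _ (S * N (i x - i z.2))).
      rewrite ler_wpM2r ?N_ge0//; first exact: DB.
      rewrite /S ge0_ler_powR ?nnegrE// ?addr_ge0// ?(ltW alpha_gt0)//.
      rewrite -[X in `|X|](subKr s) (le_trans (ler_normB _ _))// lerD2l.
      exact: ltW.
    by rewrite mulrC -ltr_pdivlMr.
  apply: (le_trans (NZ _ (Di _))).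
  apply: (@le_trans _ _ (d `^ alpha * N (i x))).
    by rewrite ler_wpM2r// ge0_ler_powR// ?nnegrE// ltW.
  by rewrite dE mulrAC ler_pdivrMr// ler_wpM2l ?divr_ge0 ?ltW// /c; lra.
- move=> F PF cF.
  (* [complete_N] speaks of filters on X, so F is pushed forward along i; a ball of radius e/2 in F
     has an image of diameter at most e. *)
  have PG : ProperFilter (i @ F) by exact: fmap_proper_filter.
  have [e e0|p Dp pF] := complete_N PG.
    have /cauchyP/(_ (e / 2)) [|x Fx] := cF; first by rewrite divr_gt0.
    exists (i @` ball x (e / 2)).
      exact: filterS (@preimage_image _ _ i _) Fx.
    split=> [_ [y _ <-]//|_ _ [y xy <-] [z xz <-]].
    move: (ball_sym xy) xz; rewrite !ballEmdist/= -iN => yx xz.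
    by rewrite (le_trans (metric_triangle y x z))// [e]splitr lerD// ltW.
  have [x xp] := exM _ Dp; exists x.
  apply/cvg_ballP => e e0; near=> y.
  rewrite ballEmdist/= iN xp.
  apply: le_lt_trans (_ : e / 2 < e); last by lra.
  by near: y; apply: pF; rewrite divr_gt0.
Unshelve. all: by end_near.
Qed.
End homogeneous_norm.

(** * Application of the abstract metric construction to the Hoelder constant of mu *)

Theorem theorem7p4 (R : realType) (X : tvsType R)
    (X_hausdorff : hausdorff_space X)
    (alpha : R) (alpha_gt0 : 0 < alpha) (alpha_le1 : alpha <= 1)
    (mu : {charge set (borel X) -> \bar R})
    (mu_radon : radon mu)
    (mu_neq0 : exists A : set (borel X), measurable A /\ mu A <> 0%E) :
  [/\ translation_invariant (hoelder_space alpha mu) (hoelder_dist alpha mu),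
      complete_metric_vector_space
        (hoelder_space alpha mu) (hoelder_dist alpha mu)
    & compactly_embedded (hoelder_space alpha mu) (hoelder_dist alpha mu)].
Proof.
split.
- by move=> h1 h2 h _ _ _; rewrite /hoelder_dist opprD addrACA subrr addr0.
- apply: (complete_homogeneous_norm alpha_gt0).
  + exact: hoelder_space0.
  + by move=> h k; exact: hoelder_spaceD.
  + by move=> s h; exact: hoelder_spaceZ.
  + exact: hoelder_const0.
  + by move=> h; exact: hoelder_const_eq0.
  + by move=> h k; exact: hoelder_constD.
  + by move=> s h; exact: hoelder_constZ.
  + by move=> F PF cF; exact: hoelder_complete.
- exact: hoelder_compactly_embedded.
Qed.
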